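(* Let $G$ be a countable group and let $(\Omega,\mathcal F,\mu,(T_g)_{g\in G})$ be a totally dissipative nonsingular $G$-action on a non-atomic measure space. Then the action is factor-universal: for every nonsingular $G$-action $(\Omega',\mathcal F',\mu',(S_g)_{g\in G})$ there is a measurable map $\pi:\Omega\to\Omega'$ such that, $\mu$-almost everywhere, $\pi\circ T_g=S_g\circ\pi$ for all $g\in G$, and $\mu\circ\pi^{-1}\sim\mu'$.
   Context: All measure spaces are standard $\sigma$-finite measure spaces with nonzero measure; $\sim$ means having the same null sets. A nonsingular automorphism of $(\Omega,\mathcal F,\mu)$ is an invertible bimeasurable map $R:\Omega\to\Omega$ with $\mu\circ R^{-1}\sim\mu$. A (nonsingular) $G$-action is a group homomorphism $g\mapsto T_g$ from $G$ to the group of nonsingular automorphisms. A set $W\in\mathcal F$ is wandering if the sets $T_gW$, $g\in G$, are pairwise disjoint. The action is totally dissipative if there is a wandering set $W$ with $\biguplus_{g\in G}T_gW=\Omega$ modulo a $\mu$-null set. The target action need not be non-atomic. *)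

(* Defs.v *)
From HB Require Import structures.
From mathcomp Require Import all_boot all_order all_algebra.
From mathcomp Require Import all_classical all_reals all_analysis.

Set Implicit Arguments.
Unset Strict Implicit.
Unset Printing Implicit Defensive.

Import Order.TTheory GRing.Theory Num.Theory.
Local Open Scope classical_set_scope.
Local Open Scope ring_scope.
Local Open Scope ereal_scope.

(* separable and complete for its given metric *)
Definition polish_metric (R : realType) (X : metricType R) : Prop :=
  (exists2 D : set X, countable D & dense D) /\
  (forall F : set_system X, ProperFilter F -> cauchy F ->
    exists x : X, F --> x).

(* Standard Borel: isomorphic, as a measurable space, to a Polish space with its
   Borel sigma-algebra. *)
Definition standard_borel (R : realType) (d : measure_display)
    (T : measurableType d) : Prop :=
  exists (X : metricType R) (f : T -> X),
    [/\ polish_metric X, bijective f &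
        forall A : set T, measurable A <->
          exists2 B : set X, <<s open >> B & f @^-1` B = A].

Definition standard_measure_space (R : realType) (d : measure_display)
    (T : measurableType d) (mu : {measure set T -> \bar R}) : Prop :=
  [/\ standard_borel R T, sigma_finite setT mu & mu setT != 0].

Definition same_null_sets (R : realType) (d : measure_display)
    (T : measurableType d) (m1 m2 : set T -> \bar R) : Prop :=
  forall A : set T, measurable A -> (m1 A = 0 <-> m2 A = 0).

Definition atom (R : realType) (d : measure_display) (T : measurableType d)
    (mu : {measure set T -> \bar R}) (A : set T) : Prop :=
  [/\ measurable A, 0 < mu A &
      forall B : set T, measurable B -> B `<=` A ->
        mu B = 0 \/ mu (A `\` B) = 0].

Definition non_atomic (R : realType) (d : measure_display)
    (T : measurableType d) (mu : {measure set T -> \bar R}) : Prop :=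
  forall A : set T, ~ atom mu A.

Definition nonsingular_automorphism (R : realType) (d : measure_display)
    (T : measurableType d) (mu : {measure set T -> \bar R})
    (f : T -> T) : Prop :=
  [/\ measurable_fun setT f,
      exists f' : T -> T,
        [/\ cancel f f', cancel f' f & measurable_fun setT f'] &
      same_null_sets (pushforward mu f) mu].

Definition nonsingular_action (G : groupType) (R : realType)
    (d : measure_display) (T : measurableType d)
    (mu : {measure set T -> \bar R}) (a : G -> T -> T) : Prop :=
  [/\ forall g, nonsingular_automorphism mu (a g),
      a 1%g = id &
      forall g h, a (g * h)%g = a g \o a h].

Definition wandering (G : groupType) (d : measure_display)
    (T : measurableType d) (a : G -> T -> T) (W : set T) : Prop :=
  measurable W /\ trivIset setT (fun g => a g @` W).

Definition totally_dissipative (G : groupType) (R : realType)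
    (d : measure_display) (T : measurableType d)
    (mu : {measure set T -> \bar R}) (a : G -> T -> T) : Prop :=
  exists2 W : set T, wandering a W &
    mu.-negligible (~` \bigcup_(g in setT) (a g @` W)).

Definition factor_universal (G : groupType) (R : realType)
    (d : measure_display) (T : measurableType d)
    (mu : {measure set T -> \bar R}) (a : G -> T -> T) : Prop :=
  forall (d' : measure_display) (T' : measurableType d')
    (mu' : {measure set T' -> \bar R}) (b : G -> T' -> T'),
    standard_measure_space mu' -> nonsingular_action mu' b ->
    exists pi : T -> T',
      [/\ measurable_fun setT pi,
          {ae mu, forall x, forall g, pi (a g x) = b g (pi x)} &
          same_null_sets (pushforward mu pi) mu'].

(* Main.v *)
Require Import Defs.
From HB Require Import structures.
From mathcomp Require Import all_boot all_order all_algebra.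
From mathcomp Require Import all_classical all_reals all_analysis.
From mathcomp Require Import measurable_realfun ring lra.

Import Order.TTheory GRing.Theory Num.Theory.
Import numFieldNormedType.Exports.

Local Open Scope classical_set_scope.
Local Open Scope ring_scope.

(** Let [W] be the wandering set of a totally dissipative action.  If
    [phi : W -> Omega'] pushes [mu] restricted to [W] to a measure equivalent to
    [mu'], then [pi (T_g w) = S_g (phi w)] is equivariant by construction, and
    nonsingularity of both actions gives [pi_* mu ~ mu'].  To obtain [phi], every
    standard Borel space is a measurable retract of the real line (with the
    section valued in [[0, 1]]), which avoids the Lusin-Souslin theorem.  Replacing
    the measures by equivalent probabilities, the first one has an atomless image
    on the line, and the quantile map of the second composed with the distribution
    function of the first transports one image to the other. *)

(** * Coding countably many measurable sets by a real number *)

(* The partial sums of [\sum_k 2 a_k / 3^(k+1)], in the recursive form that makes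
   the shift of digits visible. *)
Fixpoint ternary {R : realType} (n : nat) (a : nat -> R) : R :=
  if n is m.+1 then (2 * a 0%N + ternary m (a \o succn)) / 3 else 0.

Lemma ternary_itv {R : realType} n (a : nat -> R) :
  (forall k, 0 <= a k <= 1) -> 0 <= ternary n a <= 1.
Proof.
elim: n a => [|n IH] a a01 /=; first by rewrite lexx ler01.
have := IH _ (fun k => a01 k.+1); have := a01 0%N; lra.
Qed.

Lemma ternary_nondecreasing {R : realType} (a : nat -> R) :
  (forall k, 0 <= a k <= 1) -> nondecreasing_seq (ternary ^~ a).
Proof.
move=> a01; apply/nondecreasing_seqP => n.
elim: n a a01 => [|n IH] a a01; first by have /andP[] := ternary_itv 1 _ a01.
have := IH _ (fun k => a01 k.+1); rewrite /=; lra.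
Qed.

Lemma ternary_cvg {R : realType} (a : nat -> R) :
  (forall k, 0 <= a k <= 1) -> cvgn (ternary ^~ a).
Proof.
move=> a01; apply: nondecreasing_is_cvgn; first exact: ternary_nondecreasing.
by exists 1 => _ [n _ <-]; have /andP[] := ternary_itv n _ a01.
Qed.

Definition ternary_lim {R : realType} (a : nat -> R) : R :=
  limn (ternary ^~ a).

Lemma ternary_lim_itv {R : realType} (a : nat -> R) :
  (forall k, 0 <= a k <= 1) -> 0 <= ternary_lim a <= 1.
Proof.
move=> a01; have ca := ternary_cvg _ a01; apply/andP; split.
  by apply: limr_ge => //; near=> n; have /andP[] := ternary_itv n _ a01.
by apply: limr_le => //; near=> n; have /andP[] := ternary_itv n _ a01.
Unshelve. all: by end_near. Qed.

Lemma ternary_limE {R : realType} (a : nat -> R) :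
  (forall k, 0 <= a k <= 1) ->
  ternary_lim a = (2 * a 0%N + ternary_lim (a \o succn)) / 3.
Proof.
move=> a01; apply/cvg_lim => //; rewrite -cvg_shiftS /=.
apply: cvgM; last exact: cvg_cst.
by apply: cvgD; [exact: cvg_cst|exact: (ternary_cvg _ (fun k => a01 k.+1))].
Qed.

(* For digits 0 and 1 in [a], the value of [ternary_lim a] is at least 2/3 or at
   most 1/3 according to [a 0], so this map drops the leading digit. *)
Definition ternary_shift {R : realType} (y : R) : R :=
  3 * y - 2 * \1_`[2 / 3, +oo[%classic y.

(** Reads a digit from any real, code or not, since the decoder has to be measurable on the whole
    line. *)
Definition ternary_digit {R : realType} (k : nat) : set R :=
  iter k ternary_shift @^-1` `[2 / 3, +oo[.

Lemma measurable_ternary_digit {R : realType} k :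
  measurable (@ternary_digit R k).
Proof.
rewrite -[X in measurable X]setTI.
have : measurable_fun setT (iter k (@ternary_shift R)); last exact.
elim: k => [|k IH] /=; first exact: measurable_id.
apply: measurableT_comp IH; apply: measurable_funB; apply: measurable_funM => //.
Qed.

(** Using only the base 3 digits 0 and 2 leaves a gap around 1/2; in base 2 the sequences 1000...
    and 0111... would have the same value. Once the leading digit is read, the shift turns the code
    of [a] into that of [a \o succn], which gives the induction on [k]. *)
Lemma ternary_limP {R : realType} (a : nat -> bool) k :
  ternary_digit k (ternary_lim (fun i => (a i)%:R : R)) <-> a k.
Proof.
have a01 (b : nat -> bool) i : 0 <= ((b i)%:R : R) <= 1.
  by case: (b i); rewrite ?lexx ?ler01.
have dE (b : nat -> bool) :
    (2 / 3 <= ternary_lim (fun i => (b i)%:R : R)) = b 0%N.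
  rewrite ternary_limE //.
  have := ternary_lim_itv _ (fun i => a01 (b \o succn) i) => /=; rewrite /comp.
  by case: (b 0%N) => ?; [apply/idP|apply/negbTE]; rewrite -?ltNge /=; lra.
rewrite /ternary_digit.
elim: k a => [|k IH] a; first by rewrite /= in_itv/= andbT dE.
rewrite /preimage/= -iterS iterSr -(IH (a \o succn)) /preimage/=.
rewrite (_ : ternary_shift _ = ternary_lim (fun i => (a i.+1)%:R)) //.
rewrite /ternary_shift indicE mem_setE in_itv/= andbT dE ternary_limE //.
by rewrite /comp; field.
Qed.

(** The digits of [c x] are the indicators of the [E k] at [x]; [c] is a pointwise limit of
    measurable partial sums. *)
Lemma ternary_coding (R : realType) d (T : measurableType d) (E : nat -> set T) :
  (forall k, measurable (E k)) ->
  exists c : T -> R, [/\ measurable_fun setT c, (forall x, 0 <= c x <= 1) &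
    forall k, c @^-1` (ternary_digit k) = E k].
Proof.
move=> mE; exists (fun x => ternary_lim (fun k => \1_(E k) x)).
have a01 x k : 0 <= (\1_(E k) x : R) <= 1.
  by rewrite indicE; case: (_ \in _); rewrite ?lexx ?ler01.
split => [|x|k].
- apply: (@measurable_fun_cvg _ _ _ _
    (fun n x => ternary n (fun k => \1_(E k) x))).
    move=> n; elim: n E mE {a01} => [|n IH] E mE /=; first exact: measurable_cst.
    apply: measurable_funM => //; apply: measurable_funD; last first.
      exact: (IH (fun k => E k.+1)).
    by apply: measurable_funM => //; exact: measurable_indic.
  by move=> x _; exact: ternary_cvg.
- exact: ternary_lim_itv.
- apply/seteqP; split => x /=.
    move=> /(ternary_limP (fun k => x \in E k)); by rewrite inE.
  by move=> Ex; apply/(ternary_limP (fun k => x \in E k)); rewrite inE.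
Qed.

(** * Standard Borel spaces as measurable retracts of the line *)

Lemma measurable_forall d (T : measurableType d) (P : nat -> T -> Prop) :
  (forall n, measurable [set x | P n x]) -> measurable [set x | forall n, P n x].
Proof.
move=> mP; rewrite (_ : [set x | _] = \bigcap_n [set x | P n x]).
  exact: bigcapT_measurable.
by apply/seteqP; split => [x Px n _|x Px n]; apply: Px.
Qed.

Lemma measurable_exists d (T : measurableType d) (P : nat -> T -> Prop) :
  (forall n, measurable [set x | P n x]) ->
  measurable [set x | exists n, P n x].
Proof.
move=> mP; rewrite (_ : [set x | _] = \bigcup_n [set x | P n x]).
  exact: bigcupT_measurable.
by apply/seteqP; split => [x [n Pnx]|x [n _ Pnx]]; exists n.
Qed.

Lemma measurable_imply d (T : measurableType d) (P Q : T -> Prop) :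
  measurable [set x | P x] -> measurable [set x | Q x] ->
  measurable [set x | P x -> Q x].
Proof.
move=> mP mQ; rewrite (_ : [set x | _] = ~` [set x | P x] `|` [set x | Q x]).
  by apply: measurableU => //; exact: measurableC.
apply/seteqP; split => [x /= PQ|x /= [//|]//].
by have [/PQ|] := pselect (P x); [right|left].
Qed.

Lemma measurable_prop d (T : measurableType d) (C : Prop) :
  measurable [set _ : T | C].
Proof.
have [c|nc] := pselect C.
  by rewrite [X in measurable X](_ : _ = setT) //; apply/seteqP; split.
by rewrite [X in measurable X](_ : _ = set0) //; apply/seteqP; split.
Qed.

Lemma metric_ball_open {R : realType} (X : metricType R) (x : X) (e : R) :
  open (ball x e).
Proof.
rewrite openE => y; rewrite ballEmdist /= => xy.
apply/nbhs_ballP; exists (e - mdist x y) => /=; first by rewrite subr_gt0.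
move=> z; rewrite !ballEmdist /= => yz.
by have := metric_triangle x y z; lra.
Qed.

Lemma countable_dense_seq {R : realType} (X : metricType R) (D : set X) (x0 : X) :
  countable D -> dense D ->
  exists x : nat -> X, forall y (e : R), 0 < e -> exists i, mdist (x i) y < e.
Proof.
move=> /countable_injP[f injf] dD.
exists (fun i => xget x0 [set y | D y /\ f y = i]) => y e e0.
have [|z [byz Dz]] := dD _ _ (metric_ball_open X y e).
  by exists y; rewrite ballEmdist /= mdistxx.
exists (f z); case: xgetP => [w _ [Dw fwz]|/(_ z)]; last by case.
rewrite (injf _ _ _ _ fwz) ?inE // metric_sym.
by rewrite ballEmdist in byz.
Qed.

(** Here [b n i] stands for the ball of radius [eps n] about [x i] being selected. Choosing one
    selected centre per level gives a Cauchy sequence; its limit [z] satisfies the bound because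
    [mdist (x i) (x (s m))] is at most [eps n + eps m], and [m] may tend to infinity. *)
Lemma complete_nested_point {R : realType} (X : metricType R) (eps : nat -> R)
    (x : nat -> X) (b : nat -> nat -> Prop) :
  (forall e, 0 < e -> \forall n \near \oo, eps n < e) ->
  (forall F : set_system X, ProperFilter F -> cauchy F ->
    exists x : X, F --> x) ->
  (forall n, exists i, b n i) ->
  (forall n m i j, b n i -> b m j ->
    mdist (x i) (x j) <= eps n + eps m) ->
  exists z, forall n i, b n i -> mdist z (x i) <= eps n.
Proof.
move=> small Xcomplete /choice[s bs] bb.
have [|z xz] := Xcomplete (x \o s @ \oo) _.
  apply/cauchy_ballP => e e0; near_simpl.
  have e20 : 0 < e / 2 by rewrite divr_gt0.
  near=> p; rewrite ballEmdist/=.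
  rewrite (le_lt_trans (bb p.1 p.2 _ _ (bs _) (bs _))) // (splitr e) ltrD //.
    by near: p; exact: (cvg_fst (small _ e20)).
  by near: p; exact: (cvg_snd (small _ e20)).
exists z => n i bi; apply/ler_addgt0Pr => e e0.
have e20 : 0 < e / 2 by rewrite divr_gt0.
have zs : \forall m \near \oo, mdist z (x (s m)) < e / 2.
  have : \forall m \near \oo, ball z (e / 2) (x (s m)).
    by apply: xz; exact: nbhsx_ballx.
  by rewrite ballEmdist.
near \oo => m.
have zm : mdist z (x (s m)) < e / 2 by near: m.
have me : eps m < e / 2 by near: m; exact: small.
have := metric_triangle z (x (s m)) (x i).
have := bb _ _ _ _ (bs m) bi; lra.
Unshelve. all: by end_near. Qed.

(* A point [t] is coded by the set of balls [ball (x i) (eps n)] containing it.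
   Decoding is measurable because the code of a point [z] satisfies [z \in U], for
   [U] open, iff some coded closed ball is included in [U]. *)
Lemma standard_borel_coding (R : realType) d (T : measurableType d) (t0 : T) :
  standard_borel R T -> exists (c : T -> R) (r : R -> T),
  [/\ measurable_fun setT c, measurable_fun setT r, cancel c r &
    forall x, 0 <= c x <= 1].
Proof.
move=> [X [f [[[D cD dD] Xcomplete] [g fK gK] mT]]].
have [x xD] := countable_dense_seq X D (f t0) cD dD.
have [eps eps0 small] : exists2 eps : nat -> R, (forall n, 0 < eps n) &
    forall e, 0 < e -> \forall n \near \oo, eps n < e.
  exists (fun n => n.+1%:R^-1) => // e e0.
  exact: near_infty_natSinv_lt (PosNum e0).
(* The index [pickle (n, i)] stands for the ball of radius [eps n] about [x i]; the default pair
   only serves values of [k] that code no pair. *)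
pose E k := let p := odflt (0, 0)%N (unpickle k) in
  f @^-1` ball (x p.2) (eps p.1).
have mfU (U : set X) : open U -> measurable (f @^-1` U).
  by move=> oU; apply/mT; exists U => //; exact: sub_sigma_algebra.
have [c [mc c01 cE]] :=
  ternary_coding R d T E (fun k => mfU _ (metric_ball_open _ _ _)).
pose b y (n i : nat) := ternary_digit (pickle (n, i)) (y : R).
have mb n i : measurable [set y | b y n i] by exact: measurable_ternary_digit.
have bc t n i : b (c t) n i <-> mdist (x i) (f t) < eps n.
  have /seteqP[cE1 cE2] := cE (pickle (n, i)).
  rewrite /E pickleK /= ballEmdist in cE1 cE2.
  by split; [exact: cE1|exact: cE2].
(* These are the conditions on a code that [complete_nested_point] asks for. They quantify over
   natural numbers only, hence define a measurable set, and every [c t] satisfies them. *)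
pose good y := (forall n, exists i, b y n i) /\
  (forall n m i j, b y n i -> b y m j ->
    mdist (x i) (x j) <= eps n + eps m).
have mgood : measurable [set y | good y].
  apply: measurableI.
    by apply: measurable_forall => n; exact: measurable_exists.
  do 4!apply: measurable_forall => ?.
  by do 2!(apply: measurable_imply => //); exact: measurable_prop.
have : forall y : R, exists z, good y ->
    forall n i, b y n i -> mdist z (x i) <= eps n.
  move=> y; have [gy|ngy] := pselect (good y); last by exists (f t0).
  have [z zP] := complete_nested_point X eps x (b y) small Xcomplete gy.1 gy.2.
  by exists z.
move=> /choice[z zP].
have smalln (e : R) : 0 < e -> exists n, eps n < e.
  by move=> e0; near \oo => n; exists n; near: n; exact: small.
have goodc t : good (c t).
  split => [n|n m i j /bc ni /bc mj].
    by have [i ?] := xD (f t) (eps n) (eps0 n); exists i; apply/bc.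
  have := metric_triangle (x i) (f t) (x j); rewrite (metric_sym (f t)); lra.
pose r y := if pselect (good y) then g (z y) else t0.
exists c, r; split => //; last first.
  move=> t; rewrite /r; case: pselect => // gt.
  (* For every [n], both [z (c t)] and [f t] lie within [eps n] of a common centre, so they
     coincide. *)
  rewrite -[RHS]fK; congr g; apply: mdist_positivity; apply/eqP.
  rewrite eq_le mdist_ge0 andbT; apply/ler_addgt0Pr => e e0.
  have [n ne] : exists n, eps n < e / 2 by apply: smalln; rewrite divr_gt0.
  have [i bi] := gt.1 n.
  have := metric_triangle (z (c t)) (x i) (f t).
  have := zP _ gt _ _ bi; have := (bc _ _ _).1 bi; lra.
have mrU (U : set X) : open U -> measurable (r @^-1` (f @^-1` U)).
  move=> oU.
  (* The clause over all [w] is an uncountable quantification, but it does not depend on [y], so it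
     counts as a constant proposition for measurability. *)
  rewrite (_ : _ @^-1` _ = [set y | good y] `&`
      [set y | exists n, exists i, b y n i /\
        (forall w, mdist w (x i) <= eps n -> U w)]
    `|` ~` [set y | good y] `&` [set _ | U (f t0)]).
    apply: measurableU; apply: measurableI => //.
    - do 2!apply: measurable_exists => ?.
      by apply: measurableI; [exact: mb|exact: measurable_prop].
    - exact: measurableC.
    - exact: measurable_prop.
  apply/seteqP; split => y /=; rewrite /r.
    case: pselect => gy; last by right.
    rewrite gK => Uzy; left; split => //.
    move: oU; rewrite openE => /(_ _ Uzy)/nbhs_ballP[e /= e0 eU].
    rewrite ballEmdist in eU.
    (* The closed ball of radius [eps n] about [x i] contains [z y], so [eps n < e / 2] puts it
       inside the ball of radius [e] about [z y], hence inside [U]. *)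
    have [n ne] : exists n, eps n < e / 2 by apply: smalln; rewrite divr_gt0.
    have [i bi] := gy.1 n; exists n, i; split => // w wi.
    apply: eU => /=; have := metric_triangle (z y) (x i) w.
    rewrite (metric_sym (x i) w); have := zP _ gy _ _ bi; lra.
  case: pselect => gy; last by case=> [[]|[]].
  by rewrite gK => -[[_ [n [i [bi Ui]]]]|[]//]; apply: Ui; exact: zP.
move=> _ A /mT[B sB <-]; rewrite setTI.
have : <<s open >> `<=` [set B | measurable (r @^-1` (f @^-1` B))]; last exact.
apply: smallest_sub => //; split => [|A0 mA0|F mF] /=.
- by rewrite !preimage_set0.
- by move: mA0 => /measurableC; rewrite setTD -!preimage_setC.
- by move: mF => /bigcupT_measurable; rewrite !preimage_bigcup.
Unshelve. all: by end_near. Qed.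

(** * Transport of an atomless probability on the line *)

(** Continuity from above along the rays ending at [a + 1/(k+1)], whose intersection is the closed
    ray at [a]. *)
Lemma ray_right_continuous {R : realType} (P : probability R R) (v : \bar R) (a : R) :
  (forall e, 0 < e -> (v <= P `]-oo, (a + e)%R]%classic)%E) ->
  (v <= P `]-oo, a]%classic)%E.
Proof.
move=> vP; rewrite (itvNycEbigcap false).
have /cvg_lim <- // : P \o (fun k => `]-oo, (a + k.+1%:R^-1)%R]%classic) @ \oo
    --> P (\bigcap_k `]-oo, (a + k.+1%:R^-1)%R]%classic).
  apply: nonincreasing_cvg_mu => //.
  - by rewrite -ge0_fin_numE// fin_num_measure.
  - exact: bigcapT_measurable.
  - move=> m n mn; apply/subsetPset; apply: subset_itvl.
    by rewrite bnd_simp lerD2l lef_pV2 ?posrE// ler_nat.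
apply: lime_ge; last by near=> n; exact: vP.
apply: ereal_nonincreasing_is_cvgn => m n mn; apply: le_measure; rewrite ?inE //.
by apply: subset_itvl; rewrite bnd_simp lerD2l lef_pV2 ?posrE// ler_nat.
Unshelve. all: by end_near. Qed.

(** Continuity from below; the union of the approximating rays is only the open ray, so a mass at
    [a] itself escapes the bound. *)
Lemma ray_left_limit {R : realType} (P : probability R R) (v : \bar R) (a : R) :
  (forall e, 0 < e -> (P `]-oo, (a - e)%R]%classic <= v)%E) ->
  (P `]-oo, a[%classic <= v)%E.
Proof.
move=> vP.
have -> : `]-oo, a[%classic = \bigcup_k `]-oo, (a - k.+1%:R^-1)%R]%classic.
  apply/seteqP; split => [x /=|x [k _] /=]; rewrite !in_itv /=.
    move=> /ltr_add_invr[k xa]; exists k => //=; rewrite in_itv /=.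
    by rewrite lerBrDr ltW.
  by move=> /le_lt_trans; apply; rewrite ltrBlDr ltrDl.
have nd : nondecreasing_seq (fun k => `]-oo, (a - k.+1%:R^-1)%R]%classic).
  move=> m n mn; apply/subsetPset; apply: subset_itvl.
  by rewrite bnd_simp lerD2l lerN2 lef_pV2 ?posrE// ler_nat.
have /cvg_lim <- // : P \o (fun k => `]-oo, (a - k.+1%:R^-1)%R]%classic) @ \oo
    --> P (\bigcup_k `]-oo, (a - k.+1%:R^-1)%R]%classic).
  by apply: nondecreasing_cvg_mu => //; exact: bigcupT_measurable.
apply: lime_le; last by near=> n; exact: vP.
apply: ereal_nondecreasing_is_cvgn => m n mn; apply: le_measure; rewrite ?inE //.
by apply/subsetPset; exact: nd.
Unshelve. all: by end_near. Qed.

Lemma unit_supported_ray_lt0 {R : realType} (P : probability R R) (z : R) :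
  P `[0, 1]%classic = 1%E -> z < 0 -> P `]-oo, z]%classic = 0%E.
Proof.
move=> P01 z0; apply/eqP; rewrite eq_le measure_ge0 andbT.
have <- : P (~` `[0, 1]%classic) = 0%E by rewrite probability_setC // P01 subee.
apply: le_measure; rewrite ?inE //; first exact: measurableC.
by move=> x /=; rewrite !in_itv /=; lra.
Qed.

Lemma unit_supported_ray_ge1 {R : realType} (P : probability R R) (z : R) :
  P `[0, 1]%classic = 1%E -> 1 <= z -> P `]-oo, z]%classic = 1%E.
Proof.
move=> P01 z1; apply/eqP; rewrite eq_le probability_le1 //= -P01.
apply: le_measure; rewrite ?inE // => x /=; rewrite !in_itv /=; lra.
Qed.

Lemma ray_homo {R : realType} (P : probability R R) (y z : R) :
  y <= z -> (P `]-oo, y]%classic <= P `]-oo, z]%classic)%E.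
Proof.
by move=> yz; apply: le_measure; rewrite ?inE //; apply: subset_itvl.
Qed.

(** The probability integral transform: under [P] its own distribution function is uniform. The
    sublevel set is a ray closed at its supremum [s]: as [s] carries no mass, the left limit bounds
    the mass of the ray by [u], and right continuity gives the converse because points beyond [s]
    exceed the level. *)
Lemma atomless_cdf_uniform {R : realType} (P : probability R R) (u : \bar R) :
  (forall y : R, P [set y] = 0%E) -> P `[0, 1]%classic = 1%E ->
  (0 <= u <= 1)%E ->
  P [set y | (P `]-oo, y]%classic <= u)%E] = u.
Proof.
(* For [u = 1] the sublevel set is the whole line and has no supremum, so this case is treated
   apart. *)
move=> P1 P01 /andP[u0]; rewrite le_eqVlt => /predU1P[->|u1].
  rewrite (_ : [set _ | _] = setT) ?probability_setT //.
  by apply/seteqP; split => // y _; exact: probability_le1.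
set S := [set y | _].
have S1 : ubound S 1.
  move=> y Sy; rewrite leNgt; apply/negP => y1.
  move: Sy; rewrite /S /= (unit_supported_ray_ge1 _ _ P01 (ltW y1)).
  move=> /le_lt_trans /(_ u1).
  by rewrite ltxx.
have supS : has_sup S.
  split; last by exists 1.
  by exists (-1); rewrite /S /= unit_supported_ray_lt0 // ltrN10.
have supSu : (P `]-oo, sup S]%classic <= u)%E.
  rewrite -(setUitv1 true) // measureU //; last 1 first.
    by apply/seteqP; split => // x /= [] + xs; rewrite in_itv /= xs ltxx.
  rewrite [X in (_ + X)%E](_ : _ = 0%E); last exact: P1.
  rewrite adde0; apply: ray_left_limit => e e0.
  have [y Sy ey] := sup_adherent e0 supS.
  by apply: le_trans Sy; apply: ray_homo; exact: ltW.
have -> : S = `]-oo, sup S]%classic.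
  apply/seteqP; split => y; rewrite /= in_itv /=.
    by move=> Sy; apply: ub_le_sup => //; exact: supS.2.
  by move=> yS; apply: le_trans supSu; exact: ray_homo.
apply/eqP; rewrite eq_le supSu /=; apply: ray_right_continuous => e e0.
rewrite leNgt; apply/negP => /ltW Se.
have := ub_le_sup supS.2 Se; lra.
Qed.

(** The quantile function of [Q] is adjoint to its distribution function: [t y <= z] exactly when
    the distribution function of [P] at [y] is at most that of [Q] at [z]. By [atomless_cdf_uniform]
    the preimage of a ray then has the right mass, and rays determine a probability. *)
Lemma quantile_transport {R : realType} (P Q : probability R R) :
  (forall y : R, P [set y] = 0%E) -> P `[0, 1]%classic = 1%E ->
  Q `[0, 1]%classic = 1%E ->
  exists t : R -> R, measurable_fun setT t /\
    forall A, measurable A -> P (t @^-1` A) = Q A.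
Proof.
move=> P1 P01 Q01.
(* Without the restriction to [0, 1] this set would be unbounded below when [P] gives the ray at [y]
   mass 0; the point 1 always remains in it. *)
pose A y := [set z | 0 <= z <= 1 /\ (P `]-oo, y]%classic <= Q `]-oo, z]%classic)%E].
have A1 y : A y 1.
  by split; rewrite ?ler01 ?lexx // (unit_supported_ray_ge1 Q) // probability_le1.
have A0 y : lbound (A y) 0 by move=> z [/andP[]].
have infA y : has_inf (A y) by split; [exists 1|exists 0].
pose t y := inf (A y).
have t0 y : 0 <= t y by apply: lb_le_inf => //; exists 1.
have t1 y : t y <= 1 by apply: ge_inf => //; exact: (infA y).2.
have tA y : (P `]-oo, y]%classic <= Q `]-oo, t y]%classic)%E.
  apply: ray_right_continuous => e e0.
  have [z [_ yz] ze] := inf_adherent e0 (infA y).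
  by apply: le_trans yz _; apply: ray_homo; exact: ltW.
have tP y z : 0 <= z <= 1 ->
    t y <= z <-> (P `]-oo, y]%classic <= Q `]-oo, z]%classic)%E.
  move=> z01; split => [yz|yz]; first by apply: le_trans (tA y) _; exact: ray_homo.
  by apply: ge_inf; [exact: (infA y).2|split].
have mt : measurable_fun setT t.
  apply: nondecreasing_measurable => // y z yz.
  apply/tP; first by rewrite t0 t1.
  by apply: le_trans (tA z); exact: ray_homo.
exists t; split => // B mB.
have tray z : P (t @^-1` `]-oo, z]%classic) = Q `]-oo, z]%classic.
  have [z0|z0] := ltP z 0.
    rewrite unit_supported_ray_lt0 // (_ : _ @^-1` _ = set0) ?measure0 //.
    by apply/seteqP; split => // y; rewrite /= in_itv /=; have := t0 y; lra.
  have [z1|z1] := ltP 1 z.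
    rewrite unit_supported_ray_ge1 ?ltW // (_ : _ @^-1` _ = setT) ?probability_setT //.
    by apply/seteqP; split => // y _; rewrite /= in_itv /=; have := t1 y; lra.
  have z01 : 0 <= z <= 1 by rewrite z0.
  rewrite -[RHS](@atomless_cdf_uniform _ P) // ?measure_ge0 ?probability_le1 //.
  congr (P _); apply/seteqP; split => y /=; rewrite in_itv /=; by move/tP; exact.
(* Open upper rays are stable under intersection and generate the Borel sets; complements reduce
   them to the closed lower rays of [tray]. *)
apply/esym; apply: (@measure_unique _ _ _ (@RGenOInfty.G R)
  (fun k => `](- k%:R), +oo[%classic)
  (RGenOInfty.measurableE R) _ _ _ Q (pushforward P t)) => //.
- move=> _ _ [x ->] [y ->]; exists (Num.max x y).
  by apply/seteqP; split => z /=; rewrite !in_itv /= !andbT gt_max; case: andP.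
- by move=> k; eexists.
- apply/seteqP; split => // x _; exists (Num.truncn (- x)).+1 => //=.
  by rewrite in_itv /= andbT ltrNl truncnS_gt.
- move=> _ [x ->]; rewrite /pushforward -!setCitvl preimage_setC.
  suff : Q (~` `]-oo, x]%classic) = P (~` (t @^-1` `]-oo, x])) by [].
  rewrite !probability_setC //; last by rewrite -[X in measurable X]setTI; exact: mt.
  by rewrite tray.
- by move=> k; rewrite -ge0_fin_numE // fin_num_measure.
Qed.

(** * Factors of standard measure spaces *)

Lemma bigcup_null {R : realType} d (T : measurableType d)
    (mu : {measure set T -> \bar R}) (F : nat -> set T) :
  (forall n, measurable (F n)) ->
  mu (\bigcup_n F n) = 0%E <-> forall n, mu (F n) = 0%E.
Proof.
move=> mF; have mU : measurable (\bigcup_n F n) by exact: bigcupT_measurable.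
split => [U0 n|F0].
  by apply: (subset_measure0 _ mU _ U0) => //; exact: bigcup_sup.
apply: measure_negligible => //; apply: negligible_bigcup => n.
by apply/negligibleP => //; apply: F0.
Qed.

(** Restrict [mu] to the pieces of a countable cover of finite measure, sum with positive weights,
    which preserves null sets, and normalise. *)
Lemma equivalent_probability {R : realType} d (T : measurableType d)
    (mu : {measure set T -> \bar R}) :
  sigma_finite setT mu -> mu setT != 0%E ->
  exists P : probability T R, same_null_sets P mu.
Proof.
move=> [F FT mF] muT.
have [t0 _] : [set: T] !=set0.
  by apply/set0P; apply: contraNneq muT => ->; rewrite measure0.
(* With this weight the piece [F n] contributes at most 2^-(n+1), so the total mass is finite. *)
pose a n : R := (1 + fine (mu (F n)))^-1 / (2 ^ n.+1)%:R.
have a_gt0 n : 0 < a n.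
  by rewrite divr_gt0 // ?invr_gt0 ?ltr0n ?expn_gt0 // ltr_pwDl // fine_ge0.
pose m n : {measure set T -> \bar R} :=
  mscale (NngNum (ltW (a_gt0 n))) (mrestr mu (mF n).1).
pose nu : {measure set T -> \bar R} := mseries m 0.
have mE n A : m n A = ((a n)%:E * mu (A `&` F n))%E by [].
have nuE A : nu A = (\sum_(0 <= k <oo) m k A)%E by [].
have nu0 A : measurable A -> nu A = 0%E <-> mu A = 0%E.
  move=> mA.
  have mAF n : measurable (A `&` F n) by apply: measurableI => //; exact: (mF n).1.
  rewrite -[in mu A](setIT A) FT setI_bigcupr bigcup_null //.
  split => [nuA n|AF]; last first.
    by rewrite nuE; apply: eseries0 => n _ _; rewrite mE AF mule0.
  have : m n A = 0%E.
    move: nuA; rewrite nuE (@nneseriesD1 _ _ n) // => /eqP.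
    rewrite padde_eq0 // ?nneseries_ge0 // => /andP[/eqP -> _] //.
  rewrite mE => /eqP; rewrite mule_eq0 => /orP[|/eqP //].
  by rewrite eqe gt_eqF.
have nuT : (nu setT < +oo)%E.
  apply: (@le_lt_trans _ _ (\sum_(0 <= i <oo) (1 / (2 ^ i.+1)%:R : R)%:E)%E).
    apply: lee_nneseries => // n _; rewrite mE setTI.
    have muF : mu (F n) \is a fin_num by rewrite ge0_fin_numE // (mF n).2.
    rewrite -(fineK muF) -EFinM lee_fin /a mulrAC ler_wpM2r ?invr_ge0 ?ler0n //.
    have f0 : 0 <= fine (mu (F n)) by exact: fine_ge0.
    by rewrite mulrC ler_pdivrMr ?mul1r ?lerDr // ltr_pwDl.
  by apply: le_lt_trans (epsilon_trick0 _ _) _; rewrite ?ltry.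
have nuT0 : nu setT != 0%E by apply: contra_neq muT => /nu0; exact.
(* [mnormalize] falls back on [dirac t0] only for total mass zero or infinity, both excluded by
   [nuT0] and [nuT]. *)
pose P : probability T R := mnormalize nu (dirac t0).
have PE A : P A = (nu A * (fine (nu setT))^-1%:E)%E.
  by rewrite /P /= /mnormalize (negbTE nuT0) (lt_eqF nuT).
exists P => A mA; rewrite -nu0 // PE.
split => [/eqP|->]; last by rewrite mul0e.
rewrite mule_eq0 => /orP[/eqP //|]; rewrite eqe invr_eq0 fine_eq0 ?(negbTE nuT0) //.
by rewrite ge0_fin_numE.
Qed.

Lemma pushforward_probability {R : realType} d d' (T : measurableType d)
    (T' : measurableType d') (P : probability T R) (f : T -> T') :
  measurable_fun setT f ->
  exists P' : probability T' R, forall A, P' A = P (f @^-1` A).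
Proof.
move=> mf.
pose X : {mfun T >-> T'} := HB.pack f (isMeasurableFun.Build _ _ _ _ f mf).
by exists (distribution P X).
Qed.

(** Encode by [c], transport on the line by [t], decode by [r']. Injectivity of [c] makes fibres
    empty or singletons, so the image on the line is atomless. On the target side [r' \o c'] is the
    identity, so the range of [c'] need not be known to be measurable. *)
Lemma diffuse_transport {R : realType} d d' (T : measurableType d)
    (T' : measurableType d') (nu : {measure set T -> \bar R})
    (mu' : {measure set T' -> \bar R}) :
  standard_borel R T -> sigma_finite setT nu -> nu setT != 0%E ->
  (forall x, nu [set x] = 0%E) -> standard_measure_space mu' ->
  exists phi : T -> T',
    measurable_fun setT phi /\ same_null_sets (pushforward nu phi) mu'.
Proof.
move=> bT snu nuT nu1 [bT' smu' mu'T].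
have [t0 _] : [set: T] !=set0.
  by apply/set0P; apply: contraNneq nuT => ->; rewrite measure0.
have [t1 _] : [set: T'] !=set0.
  by apply/set0P; apply: contraNneq mu'T => ->; rewrite measure0.
have [P Pnu] := equivalent_probability _ _ _ snu nuT.
have [Q Qmu'] := equivalent_probability _ _ _ smu' mu'T.
have [c [r [mc mr cK c01]]] := standard_borel_coding _ _ _ t0 bT.
have [c' [r' [mc' mr' c'K c'01]]] := standard_borel_coding _ _ _ t1 bT'.
have [PR PRE] := pushforward_probability _ _ _ _ P _ mc.
have [QR QRE] := pushforward_probability _ _ _ _ Q _ mc'.
have mpre e e' (U : measurableType e) (V : measurableType e') (h : U -> V) A :
    measurable_fun setT h -> measurable A -> measurable (h @^-1` A).
  by move=> mh mA; rewrite -[X in measurable X]setTI; exact: mh.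
have [t [mt tE]] : exists t : R -> R, measurable_fun setT t /\
    forall A, measurable A -> PR (t @^-1` A) = QR A.
  apply: quantile_transport => [y||].
  - rewrite PRE; apply/Pnu; first exact: mpre.
    have [[x cx]|nx] := pselect (exists x, c x = y).
      rewrite -(nu1 x); congr (nu _); apply/seteqP; split => z /=.
        by rewrite -cx => /(can_inj cK).
      by move=> ->.
    rewrite -[RHS](measure0 nu); congr (nu _); apply/seteqP; split => // z /= cz.
    by apply: nx; exists z.
  - rewrite PRE (_ : _ @^-1` _ = setT) ?probability_setT //.
    by apply/seteqP; split => // x _; rewrite /= in_itv /= c01.
  - rewrite QRE (_ : _ @^-1` _ = setT) ?probability_setT //.
    by apply/seteqP; split => // x _; rewrite /= in_itv /= c'01.
exists (r' \o t \o c); split.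
  by apply: measurableT_comp => //; apply: measurableT_comp.
move=> A mA; rewrite -Qmu' // /pushforward -Pnu; last first.
  by apply: mpre => //; apply: measurableT_comp => //; apply: measurableT_comp.
have mA' : measurable (r' @^-1` A) by exact: mpre.
suff -> : P ((r' \o t \o c) @^-1` A) = Q A by [].
have := tE _ mA'; rewrite PRE QRE => PQ.
have -> : (r' \o t \o c) @^-1` A = c @^-1` (t @^-1` (r' @^-1` A)) by [].
rewrite PQ; congr (Q _).
by apply/seteqP; split => x /=; rewrite c'K.
Qed.

Lemma non_atomic_singleton {R : realType} d (T : measurableType d)
    (mu : {measure set T -> \bar R}) x :
  non_atomic mu -> measurable [set x] -> mu [set x] = 0%E.
Proof.
move=> na mx; apply/eqP/negPn/negP => mux; apply: (na [set x]); split => //.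
  by rewrite lt0e mux measure_ge0.
move=> B _ Bx.
have [->|/set0P[y By]] := eqVneq B set0; first by left; rewrite measure0.
right; rewrite (_ : _ `\` _ = set0) ?measure0 //.
by apply/seteqP; split => // z /= [-> nBx]; apply: nBx; rewrite -(Bx y By).
Qed.

Lemma countable_surj_nat (G : choiceType) (g0 : G) : countable [set: G] ->
  exists e : nat -> G, forall g, exists n, e n = g.
Proof.
move=> /countable_injP[f injf].
exists (fun n => xget g0 [set g | f g = n]) => g; exists (f g).
case: xgetP => [h _ fh|/(_ g)]; last by case.
by apply: injf; rewrite ?inE.
Qed.

(** * Images, preimages and null sets under a nonsingular action *)

Lemma actionM {G : groupType} {R : realType} {d} {T : measurableType d}
    {mu : {measure set T -> \bar R}} {a : G -> T -> T}
    (act : nonsingular_action mu a) g h x :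
  a (g * h)%g x = a g (a h x).
Proof. by case: act => _ _ ->. Qed.

Lemma actionK {G : groupType} {R : realType} {d} {T : measurableType d}
    {mu : {measure set T -> \bar R}} {a : G -> T -> T}
    (act : nonsingular_action mu a) g :
  cancel (a g) (a g^-1%g).
Proof. by move=> x; rewrite -(actionM act) mulVg; case: act => _ ->. Qed.

Lemma actionKV {G : groupType} {R : realType} {d} {T : measurableType d}
    {mu : {measure set T -> \bar R}} {a : G -> T -> T}
    (act : nonsingular_action mu a) g :
  cancel (a g^-1%g) (a g).
Proof. by move=> x; rewrite -(actionM act) mulgV; case: act => _ ->. Qed.

Lemma action_measurable {G : groupType} {R : realType} {d} {T : measurableType d}
    {mu : {measure set T -> \bar R}} {a : G -> T -> T}
    (act : nonsingular_action mu a) g A :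
  measurable A -> measurable (a g @^-1` A).
Proof.
by case: act => /(_ g)[mg _ _] _ _ mA; rewrite -[X in measurable X]setTI; exact: mg.
Qed.

Lemma action_null {G : groupType} {R : realType} {d} {T : measurableType d}
    {mu : {measure set T -> \bar R}} {a : G -> T -> T}
    (act : nonsingular_action mu a) g A :
  measurable A -> mu (a g @^-1` A) = 0%E <-> mu A = 0%E.
Proof. by case: act => /(_ g)[_ _ h] _ _; exact: h. Qed.

(** Translates of the wandering set are images; as preimages they inherit measurability and nullity
    from the action axioms. *)
Lemma action_image {G : groupType} {R : realType} {d} {T : measurableType d}
    {mu : {measure set T -> \bar R}} {a : G -> T -> T}
    (act : nonsingular_action mu a) g A :
  a g @` A = a g^-1%g @^-1` A.
Proof.
apply/seteqP; split => [_ [x Ax <-]|x Ax] /=.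
  by rewrite (actionK act).
by exists (a g^-1%g x) => //; rewrite (actionKV act).
Qed.

(** * Equivariant extension from the wandering set *)

Theorem theorem2p2 (G : groupType) (R : realType) (d : measure_display)
    (Omega : measurableType d) (mu : {measure set Omega -> \bar R})
    (T : G -> Omega -> Omega) :
  countable [set: G] ->
  standard_measure_space mu ->
  non_atomic mu ->
  nonsingular_action mu T ->
  totally_dissipative mu T ->
  factor_universal mu T.
Proof.
move=> cG [bOmega [F FT mF] muT] na act [W [mW Wdisj] Wcover].
move=> d' T' mu' S smu' actS.
have [e eG] := countable_surj_nat _ 1%g cG.
pose V g := T g @` W.
have VE g : V g = T g^-1%g @^-1` W by rewrite /V (action_image act).
have mV g : measurable (V g) by rewrite VE; exact: action_measurable act _ _ mW.
pose U := \bigcup_n V (e n).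
have mU : measurable U by exact: bigcupT_measurable.
have UE : \bigcup_(g in setT) V g = U.
  apply/seteqP; split => x [g _ Vx]; last by exists (e g).
  by have [n ng] := eG g; exists n => //; rewrite ng.
have muU : mu (~` U) = 0%E.
  by apply/negligibleP; [exact: measurableC|rewrite -UE].
have nullU A : measurable A ->
    mu A = 0%E <-> forall g, mu (V g `&` A) = 0%E.
  move=> mA; split => [A0 g|VA].
    apply: (subset_measure0 _ mA _ A0) => //; first exact: measurableI.
  apply: measure_negligible => //.
  apply: (@negligibleS _ _ _ _ (\bigcup_n (V (e n) `&` A) `|` ~` U)).
    by rewrite -setI_bigcupl -/U => x Ax; have [Ux|nUx] := pselect (U x); [left|right].
  apply: negligibleU; last by apply/negligibleP => //; exact: measurableC.
  apply: negligible_bigcup => n.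
  by apply/negligibleP; [exact: measurableI|exact: VA].
(* A null [W] would have only null translates by nonsingularity, making [Omega] null. *)
have muW : mu W != 0%E.
  apply: contra_neq muT => W0; apply/nullU => // g.
  by rewrite setIT VE; apply/(action_null act).
have m1 (x : Omega) : measurable [set x].
  have [c [r [mc _ cK _]]] := standard_borel_coding _ _ _ x bOmega.
  rewrite (_ : [set x] = c @^-1` [set c x]); last first.
    by apply/seteqP; split => y /= => [->|/(can_inj cK)].
  by rewrite -[X in measurable X]setTI; exact: mc.
(* [phi] is defined on all of [Omega], but the restricted measure sees only its values on [W]. *)
have [phi [mphi phi0]] : exists phi : Omega -> T', measurable_fun setT phi /\
    same_null_sets (pushforward (mrestr mu mW) phi) mu'.
  apply: diffuse_transport => //.
  - exists F => // i; have [mFi Fi] := mF i; split => //.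
    apply: le_lt_trans Fi; apply: le_measure; rewrite ?inE //; exact: measurableI.
  - by rewrite /= /mrestr setTI.
  - move=> x; have := non_atomic_singleton _ _ _ x na (m1 x).
    by apply: subset_measure0 => //; exact: measurableI.
have mpre A : measurable A -> measurable (phi @^-1` A).
  by move=> mA; rewrite -[X in measurable X]setTI; exact: mphi.
(* The value is well defined on [U] because disjointness of the translates determines [g]; off [U],
   a null set, [phi x] is a convenient measurable default. *)
have : forall x, exists y,
    (forall g, V g x -> y = S g (phi (T g^-1%g x))) /\ (~ U x -> y = phi x).
  move=> x; have [Ux|nUx] := pselect (U x).
    have [n _ Vx] := Ux; exists (S (e n) (phi (T (e n)^-1%g x))); split => // g Vg.
    by have -> : g = e n by apply: (Wdisj g (e n)) => //; exists x.
  exists (phi x); split => // g Vg; case: nUx; rewrite -UE; by exists g.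
move=> /choice[pi piP].
have piV g x : V g x -> pi x = S g (phi (T g^-1%g x)) by exact: (piP x).1.
have piVA g A : V g `&` pi @^-1` A =
    T g^-1%g @^-1` (W `&` phi @^-1` (S g @^-1` A)).
  rewrite VE; apply/seteqP; split => x [Wx Ax]; split => //=.
    by rewrite -piV // VE.
  by rewrite /= (piV g) // VE.
have mpi A : measurable A -> measurable (pi @^-1` A).
  move=> mA; rewrite (_ : _ @^-1` _ =
      \bigcup_n (V (e n) `&` pi @^-1` A) `|` ~` U `&` phi @^-1` A).
    apply: measurableU.
      apply: bigcupT_measurable => n; rewrite piVA.
      apply: (action_measurable act); apply: measurableI => //.
      by apply: mpre; exact: (action_measurable actS).
    by apply: measurableI; [exact: measurableC|exact: mpre].
  rewrite -setI_bigcupl -/U; apply/seteqP; split => x /=.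
    by have [Ux|nUx] := pselect (U x);
      [left|right; split => //=; rewrite -((piP x).2 nUx)].
  by case=> -[] // nUx; rewrite /= ((piP x).2 nUx).
exists pi; split.
- by move=> _ A mA; rewrite setTI; exact: mpi.
- exists (~` U); split => //; first exact: measurableC.
  move=> x /= nx Ux; apply: nx => h; case: Ux => n _ Vx.
  have Vhx : V (h * e n)%g (T h x).
    by case: Vx => w Ww <-; exists w => //; rewrite (actionM act).
  rewrite (piV _ _ Vhx) (piV _ _ Vx) (actionM actS).
  by rewrite invgM (actionM act) (actionK act).
- move=> A mA; rewrite /pushforward nullU; last exact: mpi.
  (* Each translate alone already detects the null sets of [mu']: nonsingularity of [T] brings the
     question back to [W], [phi0] passes to [mu'], and nonsingularity of [S] removes [S g]. *)
  have nullV g : mu (V g `&` pi @^-1` A) = 0%E <-> mu' A = 0%E.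
    have mSA := action_measurable actS g _ mA.
    rewrite piVA (action_null act) //; last first.
      by apply: measurableI => //; exact: mpre.
    rewrite -(action_null actS g _ mA) -(phi0 _ mSA).
    by rewrite /pushforward /= /mrestr setIC.
  by split => [/(_ 1%g)/nullV|A0 g]; last exact/nullV.
Qed.
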